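(* Let $n\ge 1$ and let $A,B\in\mathbb{C}^{n\times n}$ be matrices which commute. Assume that $\mu\in\mathbb{C}$ with $\mathrm{Re}(\mu)\ge 1$ is such that $\frac{m(\mu)}{m(\mu-1)}\in\mathrm{spec}(B)$ and $\frac{m(p+\mu)}{m(p+\mu-1)}\notin\mathrm{spec}(B)$ for all integers $p\ge 1$. Let $\lambda\in\mathbb{C}$. Then $y(z)=\sum_{p\ge 0}s_pz^{p+\mu}$ (with $s_p\in\mathbb{C}^n$) is a formal solution of the linear system of moment differential equations $$z\,\partial_m y=(zA+B)y$$ if and only if $$y(z)=h(z)\widetilde{y}(z),$$ where $\widetilde{y}\in (z^{\mu}\mathbb{C}[[z]])^n$ is a formal solution of $$z\,\partial_m\widetilde{y}(z)=\big(z(A-\lambda I)+B\big)\widetilde{y}(z).$$ Here $h(z)=\sum_{p=0}^{\infty}h_pz^p\in\mathbb{C}^{n\times n}[[z]]$ is defined by $h_0=I$ and, for all $p\ge 1$, $$\left(\frac{m(p+\mu)}{m(p+\mu-1)}-\frac{m(\mu)}{m(\mu-1)}\right)h_p=\sum_{j=0}^{p-1}h_j\left(\lambda\,\widehat{s}_{p-j-1}-\left(\frac{m(p+\mu)}{m(p+\mu-1)}-\frac{m(p+\mu-j)}{m(p+\mu-j-1)}\right)\widehat{s}_{p-j}\right),$$ where $\widehat{s}_0=I$ and $$\widehat{s}_k:=\prod_{i=0}^{k-1}\left(\left(\frac{m(k+\mu-i)}{m(k+\mu-i-1)}I-B\right)^{-1}(A-\lambda I)\right),\qquad k\ge 1 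.$$
   Context: Let $m:\{z\in\mathbb{C}:\mathrm{Re}(z)\ge 0\}\to\mathbb{C}$ be a function whose restriction to the nonnegative integers is a sequence of positive real numbers $(m(p))_{p\ge 0}$. Whenever a quotient $\frac{m(\mu+p)}{m(\mu+p-1)}$ ($p\ge 0$) is used, its denominator is understood to be nonzero. For $\nu\in\mathbb{C}$ with $\mathrm{Re}(\nu)\ge 1$, let $z^{\nu}\mathbb{C}[[z]]=\{\sum_{p\ge 0}a_pz^{\nu+p}:a_p\in\mathbb{C}\}$ (formal expressions). The moment derivative $\partial_m$ is defined on it by $$\partial_m\Big(\sum_{p\ge 0}a_pz^{p+\nu}\Big)=\sum_{p\ge 0}a_p\frac{m(p+\nu)}{m(p+\nu-1)}z^{p+\nu-1},$$ and acts componentwise on vectors. Products of elements of $\mathbb{C}^{n\times n}[[z]]$ with elements of $(z^{\mu}\mathbb{C}[[z]])^n$ are Cauchy products. $\mathrm{spec}(B)$ is the set of eigenvalues of $B$; $I$ is the identity matrix. *)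

(* Defs.v *)
From HB Require Import structures.
From mathcomp Require Import all_boot all_order all_algebra.
From mathcomp Require Import reals.
From mathcomp Require Export complex.

Set Implicit Arguments.
Unset Strict Implicit.
Unset Printing Implicit Defensive.
Import Order.TTheory GRing.Theory Num.Theory.
Local Open Scope ring_scope.

(* V[[z]], by coefficients: G p is the coefficient of z^p. *)
Definition fps (V : Type) : Type := nat -> V.

(* z^nu V[[z]], by coefficients: y p is the coefficient of z^(p + nu).
   The exponent nu is recorded in the type only. *)
Definition zfps (R : realType) (nu : R[i]) (V : Type) : Type := nat -> V.

Section MomentDifferentiation.
Variables (R : realType) (m : R[i] -> R[i]).

Definition moment_ratio (x : R[i]) : R[i] := m x / m (x - 1).

(* On column vectors *: is entrywise, so this is the componentwise action. *)
Definition moment_deriv (V : lmodType R[i]) (nu : R[i]) (y : zfps nu V) :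
    zfps (nu - 1) V :=
  fun p => moment_ratio (p%:R + nu) *: y p.

(* z * z^(p + (nu - 1)) = z^(p + nu): the coefficients are unchanged, only the
   exponents are shifted. *)
Definition zmul (V : Type) (nu : R[i]) (y : zfps (nu - 1) V) : zfps nu V :=
  fun p => y p.

Definition cauchy_mul (n : nat) (nu : R[i])
    (G : fps 'M[R[i]]_n) (y : zfps nu 'cV[R[i]]_n) : zfps nu 'cV[R[i]]_n :=
  fun p => \sum_(j < p.+1) G j *m y (p - j)%N.

(* The polynomial z A + B. *)
Definition linear_fps (n : nat) (A B : 'M[R[i]]_n) : fps 'M[R[i]]_n :=
  fun k => if k is k'.+1 then (if k' is 0%N then A else 0) else B.

Definition formal_solution (n : nat) (A B : 'M[R[i]]_n) (nu : R[i])
    (y : zfps nu 'cV[R[i]]_n) : Prop :=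
  zmul (moment_deriv y) =1 cauchy_mul (linear_fps A B) y.

Definition shat (n : nat) (A B : 'M[R[i]]_n) (mu lambda : R[i]) (k : nat) :
    'M[R[i]]_n :=
  \big[mulmx/1%:M]_(i < k)
    (invmx ((moment_ratio (k%:R + mu - i%:R))%:M - B) *m (A - lambda%:M)).

Definition gauge_series (n : nat) (A B : 'M[R[i]]_n) (mu lambda : R[i])
    (h : fps 'M[R[i]]_n) : Prop :=
  h 0%N = 1%:M /\
  forall p : nat, (1 <= p)%N ->
    (moment_ratio (p%:R + mu) - moment_ratio mu) *: h p =
    \sum_(j < p) h j *m
      (lambda *: shat A B mu lambda (p - j - 1)
       - (moment_ratio (p%:R + mu) - moment_ratio (p%:R + mu - j%:R))
           *: shat A B mu lambda (p - j)).

End MomentDifferentiation.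

(* Main.v *)
Require Import Defs.
From mathcomp Require Import all_boot all_order all_algebra.
From mathcomp Require Import reals complex.
Import Order.TTheory GRing.Theory Num.Theory.
Local Open Scope ring_scope.

(** Write [r p] for the moment ratio at [p + mu].  Comparing coefficients,
    [z d_m y = (z C + B) y] says that [(r 0 - B) y_0 = 0] and
    [(r p - B) y_p = C y_(p-1)] for [p >= 1].  As [r p] is not an eigenvalue of
    [B] for [p >= 1], a solution is exactly a sequence [y_p = T_C p y_0] with
    [y_0] in the kernel of [r 0 - B], where [T_C] is the product of resolvents
    [transfer] (which is the [shat] of the statement when [C = A - lambda])
    (lemma [moment_recurrenceP]).  Both systems therefore have the same initial
    values, and the equivalence reduces to the identity
    [T_A p v = sum_(j <= p) h_j T_(A - lambda) (p - j) v] for [v] in that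
    kernel (lemma [transfer_gauge]).

    Let [c_p] be the matrix [sum_(j <= p) h_j T_(A - lambda) (p - j)].  All
    matrices in sight are built from [A], [B] and inverses, hence commute with
    [A] and [B], and the recursion for [h] is precisely what makes
    [(r p - B) c_p - A c_(p-1) = h_p (r 0 - B)] hold for [p >= 1] (lemma
    [gauge_product_step]).  The right-hand side kills the kernel of [r 0 - B],
    so on that kernel [c] obeys the recursion of [T_A].

    Finally, [r p != r 0] for [p >= 1] because [r 0] is an eigenvalue of
    [B] and [r p] is not; so the recursion has exactly one solution [h]. *)

(** * Recursive definition of sequences *)

(** The values below [k] are stable once the recursion has been iterated [k]
    times from any start, so the diagonal of the iterates is a fixed point. *)
Lemma causal_fixpoint (V : Type) (x0 : V) (G : (nat -> V) -> nat -> V) :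
    (forall p g g', (forall j, (j < p)%N -> g j = g' j) -> G g p = G g' p) ->
  exists h, h =1 G h.
Proof.
move=> causalG; pose it k := iter k G (fun=> x0).
have it_stable k k' p : (p < k)%N -> (p < k')%N -> it k p = it k' p.
  elim: k k' p => // k IHk [|k'] // p ltpk ltpk'; apply: causalG => j ltjp.
  by apply: IHk; apply: leq_trans ltjp _.
exists (fun p => it p.+1 p) => p; apply: (causalG) => j ltjp.
exact: it_stable.
Qed.

(** * The recursion satisfied by the coefficients of a solution *)

Set Implicit Arguments.
Unset Strict Implicit.

Section MomentRecurrence.
Variables (F : fieldType) (n : nat).
Implicit Types (A B C X : 'M[F]_n) (r : nat -> F).

Lemma eigenvalue_unitmx B a : eigenvalue B a = (a%:M - B \notin unitmx).
Proof.
rewrite /eigenvalue /eigenspace kermx_eq0 row_free_unit.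
by rewrite -opprB -scaleN1r unitmxZ ?unitrN1.
Qed.

Lemma comm_mx_invmx X C : comm_mx X C -> comm_mx X (invmx C).
Proof.
move=> XC; have [uC|nuC] := boolP (C \in unitmx); last by rewrite invmx_out.
by rewrite /comm_mx -{1}[X](mulKmx uC) -XC -!mulmxA mulmxV ?mulmx1.
Qed.

Lemma scalar_mx_shift a b B : a%:M - B = (a - b)%:M + (b%:M - B).
Proof. by rewrite addrA -raddfD subrK. Qed.

Definition moment_recurrence C B r (s : nat -> 'cV[F]_n) : Prop :=
  ((r 0)%:M - B) *m s 0%N = 0 /\
  forall p, ((r p.+1)%:M - B) *m s p.+1 = C *m s p.

(** The fundamental solution: the coefficient [p] of a solution is
    [transfer C B r p] times its coefficient [0]. *)
Fixpoint transfer C B r (p : nat) : 'M[F]_n :=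
  if p is q.+1 then invmx ((r p)%:M - B) *m C *m transfer C B r q else 1%:M.

Definition gauge_recurrence C B r (lambda : F) (h : nat -> 'M[F]_n) : Prop :=
  h 0%N = 1%:M /\
  forall p, (1 <= p)%N ->
    (r p - r 0%N) *: h p =
    \sum_(j < p) h j *m (lambda *: transfer C B r (p - j - 1)
                         - (r p - r (p - j)%N) *: transfer C B r (p - j)).

Definition gauge_product (h T : nat -> 'M[F]_n) (p : nat) : 'M[F]_n :=
  \sum_(j < p.+1) h j *m T (p - j)%N.

Lemma comm_transfer X C B r p :
  comm_mx X C -> comm_mx X B -> comm_mx X (transfer C B r p).
Proof.
move=> XC XB; elim: p => [|p IHp] /=; first exact: comm_mx1.
apply: comm_mxM IHp; apply: comm_mxM => //; apply: comm_mx_invmx.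
by apply: comm_mxB => //; apply: comm_mx_scalar.
Qed.

Section NonResonant.
Variables (B : 'M[F]_n) (r : nat -> F).
Hypothesis r_nspec : forall p, (1 <= p)%N -> ~~ eigenvalue B (r p).

Lemma resolvent_unitmx p : (r p.+1)%:M - B \in unitmx.
Proof. by have := r_nspec (ltn0Sn p); rewrite eigenvalue_unitmx negbK. Qed.

Lemma transferS C p :
  ((r p.+1)%:M - B) *m transfer C B r p.+1 = C *m transfer C B r p.
Proof. by rewrite /= !mulmxA mulmxV ?mul1mx ?resolvent_unitmx. Qed.

Lemma moment_recurrenceP C s :
  moment_recurrence C B r s <->
  ((r 0)%:M - B) *m s 0%N = 0 /\ (forall p, s p = transfer C B r p *m s 0%N).
Proof.
split=> [] [s0 sS]; split=> // p; last first.
  by rewrite sS mulmxA transferS -mulmxA -sS.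
elim: p => [|p IHp]; first by rewrite mul1mx.
by rewrite /= -!mulmxA -IHp -sS mulKmx ?resolvent_unitmx.
Qed.

Hypothesis r0_spec : eigenvalue B (r 0%N).

Lemma ratio_gap_neq0 p : (1 <= p)%N -> r p - r 0%N != 0.
Proof.
move=> p_gt0; rewrite subr_eq0.
by apply: contraTneq r0_spec => <-; apply: r_nspec.
Qed.

Lemma gauge_recurrence_exists C lambda :
  exists h, gauge_recurrence C B r lambda h.
Proof.
pose G (h : nat -> 'M[F]_n) p := if p is 0%N then 1%:M else
  (r p - r 0%N)^-1 *:
    \sum_(j < p) h j *m (lambda *: transfer C B r (p - j - 1)
                         - (r p - r (p - j)%N) *: transfer C B r (p - j)).
have [|h hG] := @causal_fixpoint _ 0 G.
  move=> [|p] // g g' eq_g; congr (_ *: _); apply: eq_bigr => j _.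
  by rewrite eq_g.
exists h; split=> [|[|p] // p_gt0]; first by rewrite hG.
by rewrite hG /G scalerA divff ?scale1r ?ratio_gap_neq0.
Qed.

Lemma gauge_recurrence_unique C lambda h h' :
  gauge_recurrence C B r lambda h -> gauge_recurrence C B r lambda h' ->
  h =1 h'.
Proof.
move=> [h0 hS] [h'0 h'S] p; elim/ltn_ind: p => [[|p]] IHp.
  by rewrite h0 h'0.
apply: (scalerI (ratio_gap_neq0 (ltn0Sn p))); rewrite hS // h'S //.
by apply: eq_bigr => j _; rewrite IHp.
Qed.

Lemma comm_gauge X C lambda h p :
    comm_mx X C -> comm_mx X B -> gauge_recurrence C B r lambda h ->
  comm_mx X (h p).
Proof.
move=> XC XB [h0 hS]; elim/ltn_ind: p => [[|p]] IHp.
  by rewrite h0; apply: comm_mx1.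
have commZ a Y : comm_mx X Y -> comm_mx X (a *: Y).
  by move=> XY; rewrite /comm_mx -scalemxAl -scalemxAr XY.
rewrite -[h _](scalerK (ratio_gap_neq0 (ltn0Sn p))) hS //; apply: (commZ).
apply: comm_mx_sum => j _; apply: comm_mxM; first exact: IHp.
by apply: comm_mxB; apply/commZ/comm_transfer.
Qed.

Section Gauge.
Variables (A : 'M[F]_n) (lambda : F) (h : nat -> 'M[F]_n).
Hypothesis commAB : comm_mx A B.
Let C := A - lambda%:M.
Hypothesis hP : gauge_recurrence C B r lambda h.
Let T := transfer C B r.

(** For [j <= p] the summand [h_j T (p + 1 - j)] is moved past [r (p+1) - B] by
    writing [r (p+1) = (r (p+1) - r (p+1-j)) + r (p+1-j)]: the second part
    turns it into [h_j C T (p - j)], and the sum defining [h (p+1)] cancels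
    the first part and adds [lambda h_j T (p - j)], replacing [C] by [A].  The
    summand [j = p + 1] has no such partner, as [r 0 - B] is singular; it leaves
    the error term. *)
Lemma gauge_product_step p :
  ((r p.+1)%:M - B) *m gauge_product h T p.+1 =
    A *m gauge_product h T p + h p.+1 *m ((r 0%N)%:M - B).
Proof.
have AC : comm_mx A C by apply: comm_mxB => //; apply: comm_mx_scalar.
have BC : comm_mx B C.
  by apply: comm_mxB; [apply: comm_mx_sym | apply: comm_mx_scalar].
have Ah j : A *m h j = h j *m A by apply: comm_gauge hP.
have Dh q j : ((r q)%:M - B) *m h j = h j *m ((r q)%:M - B).
  rewrite mulmxBl mulmxBr scalar_mxC; congr (_ - _).
  exact: comm_gauge hP.
have h_last : h p.+1 *m ((r p.+1)%:M - B) =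
    (r p.+1 - r 0%N) *: h p.+1 + h p.+1 *m ((r 0%N)%:M - B).
  by rewrite (scalar_mx_shift _ (r 0%N)) mulmxDr mul_mx_scalar.
rewrite /gauge_product big_ord_recr /= subnn mulmx1 mulmxDr Dh h_last addrA.
congr (_ + _); rewrite (hP.2 _ (ltn0Sn p)) !mulmx_sumr -big_split /=.
apply: eq_bigr => -[j ltjp] _ /=; rewrite !mulmxA Dh Ah -!mulmxA -mulmxDr.
congr (_ *m _); rewrite subn1 subSn //= -/C -/T.
rewrite (scalar_mx_shift _ (r (p - j).+1)) mulmxDl transferS mul_scalar_mx addrC.
by rewrite addrA subrK -mul_scalar_mx -mulmxDl addrC subrK.
Qed.

(** On the kernel of [r 0 - B] the series [h] carries the fundamental solution
    for [C] to the one for [A]: the error term of [gauge_product_step]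
    vanishes there. *)
Lemma transfer_gauge (v : 'cV[F]_n) p :
  ((r 0%N)%:M - B) *m v = 0 -> gauge_product h T p *m v = transfer A B r p *m v.
Proof.
move=> v0; elim: p => [|p IHp].
  by rewrite /gauge_product big_ord1 hP.1 mulmx1.
apply: (can_inj (mulKmx (resolvent_unitmx p))).
rewrite [LHS]mulmxA gauge_product_step mulmxDl -2!(mulmxA _ _ v) v0 mulmx0.
by rewrite addr0 IHp [RHS]mulmxA transferS -mulmxA.
Qed.

Lemma moment_recurrence_gauge (s : nat -> 'cV[F]_n) :
  moment_recurrence A B r s <->
  exists2 t, moment_recurrence C B r t &
    forall p, s p = \sum_(j < p.+1) h j *m t (p - j)%N.
Proof.
have gauge_sol t p : moment_recurrence C B r t ->
    \sum_(j < p.+1) h j *m t (p - j)%N = transfer A B r p *m t 0%N.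
  move=> /moment_recurrenceP[t0 tT]; rewrite -transfer_gauge //.
  by rewrite mulmx_suml; apply: eq_bigr => j _; rewrite -mulmxA -tT.
split=> [/moment_recurrenceP[s0 sT] | [t tC st]].
  have tC : moment_recurrence C B r (fun p => T p *m s 0%N).
    by apply/moment_recurrenceP; split=> [|p]; rewrite /= mul1mx.
  exists (fun p => T p *m s 0%N) => // p.
  by rewrite (gauge_sol _ _ tC) mul1mx -sT.
have [t0 _] := (moment_recurrenceP _ _).1 tC.
have st0 : s 0%N = t 0%N by rewrite st big_ord1 hP.1 mul1mx.
by apply/moment_recurrenceP; rewrite st0; split=> // p; rewrite st gauge_sol.
Qed.

End Gauge.
End NonResonant.
End MomentRecurrence.

(** * Coefficients of the moment differential system *)

Lemma formal_solutionP (R : realType) (m : R[i] -> R[i]) (n : nat)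
    (C B : 'M[R[i]]_n) (mu : R[i]) (s : zfps mu 'cV[R[i]]_n) :
  formal_solution m C B s <->
  moment_recurrence C B (fun p => moment_ratio m (p%:R + mu)) s.
Proof.
have eq0 : cauchy_mul (linear_fps C B) s 0%N = B *m s 0%N.
  by rewrite /cauchy_mul big_ord1.
have eqS p : cauchy_mul (linear_fps C B) s p.+1 = B *m s p.+1 + C *m s p.
  rewrite /cauchy_mul 2!big_ord_recl big1 ?addr0 => [|j _]; last exact: mul0mx.
  by rewrite /= subn0 subn1.
split=> [sol|[s0 sS] [|p]]; rewrite /zmul /moment_deriv.
- split=> [|p]; have := sol _; rewrite /zmul /moment_deriv => {}sol.
    by rewrite mulmxBl mul_scalar_mx sol eq0 subrr.
  by rewrite mulmxBl mul_scalar_mx sol eqS addrAC subrr add0r.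
- by rewrite eq0; apply/eqP; rewrite -subr_eq0 -mul_scalar_mx -mulmxBl s0.
- by rewrite eqS -sS mulmxBl mul_scalar_mx [RHS]addrC subrK.
Qed.

Lemma shat_transfer (R : realType) (m : R[i] -> R[i]) (n : nat)
    (A B : 'M[R[i]]_n) (mu lambda : R[i]) (k : nat) :
  shat m A B mu lambda k =
  transfer (A - lambda%:M) B (fun p => moment_ratio m (p%:R + mu)) k.
Proof.
rewrite /shat; under eq_bigr => i _.
  rewrite addrAC -natrB ?(ltnW (ltn_ord i)) //.
over.
elim: k => [|k IHk]; first by rewrite big_ord0.
by rewrite big_ord_recl /= subn0 -IHk.
Qed.

Lemma gauge_seriesP (R : realType) (m : R[i] -> R[i]) (n : nat)
    (A B : 'M[R[i]]_n) (mu lambda : R[i]) (h : fps 'M[R[i]]_n) :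
  gauge_series m A B mu lambda h <->
  gauge_recurrence (A - lambda%:M) B
    (fun p => moment_ratio m (p%:R + mu)) lambda h.
Proof.
have termE p (j : 'I_p) : p%:R + mu - j%:R = (p - j)%N%:R + mu.
  by rewrite addrAC -natrB // ltnW.
rewrite /gauge_series /gauge_recurrence add0r.
split=> -[h0 hS]; split=> // p p_gt0; rewrite hS //;
  by apply: eq_bigr => j _; rewrite !shat_transfer termE.
Qed.

Unset Implicit Arguments.
Set Strict Implicit.

(* [0 < m p%:R] in R[i] says that m p is real and positive.  [m] is only ever
   evaluated on the half-plane Re z >= 0, because 1 <= Re mu. *)
Theorem lemma4p1 (R : realType) (m : R[i] -> R[i])
    (m_pos : forall p : nat, 0 < m p%:R)
    (n : nat) (n_ge1 : (1 <= n)%N)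
    (A B : 'M[R[i]]_n) (commAB : comm_mx A B)
    (mu : R[i]) (Re_mu : 1 <= complex.Re mu)
    (m_neq0 : forall p : nat, m (mu + p%:R - 1) != 0)
    (mu_spec : eigenvalue B (moment_ratio m mu))
    (mu_nspec : forall p : nat, (1 <= p)%N ->
       ~~ eigenvalue B (moment_ratio m (p%:R + mu)))
    (lambda : R[i]) :
  exists h : fps 'M[R[i]]_n,
    [/\ gauge_series m A B mu lambda h,
        (forall h' : fps 'M[R[i]]_n,
           gauge_series m A B mu lambda h' -> h' =1 h) &
        forall s : zfps mu 'cV[R[i]]_n,
          formal_solution m A B s <->
          exists2 t : zfps mu 'cV[R[i]]_n,
            formal_solution m (A - lambda%:M) B t & s =1 cauchy_mul h t].
Proof.
pose r p := moment_ratio m (p%:R + mu).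
have r_nspec p : (1 <= p)%N -> ~~ eigenvalue B (r p) by apply: mu_nspec.
have r0_spec : eigenvalue B (r 0%N) by rewrite /r add0r.
have [h hP] := gauge_recurrence_exists r_nspec r0_spec (A - lambda%:M) lambda.
exists h; split=> [|h' /gauge_seriesP h'P|s]; first exact/gauge_seriesP.
  exact: (gauge_recurrence_unique r_nspec r0_spec h'P hP).
split=> [/formal_solutionP sA | [t /formal_solutionP tC st]].
  have [t tC st] := (moment_recurrence_gauge r_nspec r0_spec commAB hP s).1 sA.
  by exists t; first exact/formal_solutionP.
apply/formal_solutionP/(moment_recurrence_gauge r_nspec r0_spec commAB hP).
by exists t.
Qed.
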